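(* For every $k\in\mathbb{N}$, $$ \sum_{\nu=1}^{k} \bigg\{ \sum_{\substack{m,n\geq 1 \\ m \equiv n\ (\mathrm{mod}\ 3)}}\frac{1}{n^\nu(m+n)^{k+2-\nu}}\bigg\}=\frac{1}{3^{k+2}}\zeta(k+2)+\frac{\pi}{3\sqrt{3}}L(k+1;\chi_3). $$
   Context: $\mathbb{N}$ is the set of positive integers; $m,n$ are integers. $\zeta$ is the Riemann zeta-function, $\chi_3$ is the quadratic Dirichlet character of conductor $3$, and $L(s;\chi)=\sum_{n\geq 1}\chi(n)n^{-s}$. *)

(* Defs.v *)
From mathcomp Require Import all_boot all_order all_algebra.
From mathcomp Require Import all_classical all_reals all_analysis.
Set Implicit Arguments.
Unset Strict Implicit.
Unset Printing Implicit Defensive.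
Import Order.TTheory GRing.Theory Num.Theory.
Import numFieldNormedType.Exports.
Local Open Scope classical_set_scope.
Local Open Scope ring_scope.

(* Dirichlet characters are taken with real values, which is enough for
   quadratic ones; they are seen as functions on the natural numbers. *)
Definition dirichlet_character (R : realType) (q : nat) (chi : nat -> R) : Prop :=
  [/\ forall n, chi (n + q)%N = chi n,
      forall m n, chi (m * n)%N = chi m * chi n &
      forall n, (chi n != 0) = coprime n q].

Definition has_conductor (R : realType) (q : nat) (chi : nat -> R) : Prop :=
  dirichlet_character q chi /\
  forall d : nat, (d %| q)%N ->
    (forall n, coprime n q -> n = 1 %[mod d] -> chi n = 1) -> d = q.

(* The character has order exactly two in the group of characters mod [q]. *)
Definition quadratic_character (R : realType) (q : nat) (chi : nat -> R) : Prop :=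
  (forall n, coprime n q -> chi n ^+ 2 = 1) /\
  (exists2 n, coprime n q & chi n != 1).

Definition chi3 (R : realType) (n : nat) : R :=
  if (n %% 3 == 1)%N then 1 else if (n %% 3 == 2)%N then -1 else 0.

Lemma chi3_mod (R : realType) n : chi3 R n = chi3 R (n %% 3)%N.
Proof. by rewrite /chi3 modn_mod. Qed.

Lemma coprime3E n : coprime n 3 = (n %% 3 != 0)%N.
Proof. by rewrite coprime_sym prime_coprime. Qed.

Lemma mod3P n : [\/ n %% 3 = 0, n %% 3 = 1 | n %% 3 = 2]%N.
Proof.
have := ltn_pmod n (isT : 0 < 3)%N.
by case: (n %% 3)%N => [|[|[|]]] // _; [apply: Or31|apply: Or32|apply: Or33].
Qed.

(* [chi3] is the quadratic Dirichlet character of conductor 3. *)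
Lemma chi3P (R : realType) (chi : nat -> R) :
  has_conductor 3 chi /\ quadratic_character 3 chi <-> chi = chi3 R.
Proof.
split=> [[[[per mul supp] _] [sq [a ca na1]]]|->].
  have perm n : chi n = chi (n %% 3)%N.
    rewrite [in LHS](divn_eq n 3) addnC; elim: (n %/ 3)%N => [|j IH].
      by rewrite mul0n addn0.
    by rewrite mulSn addnCA addnC per.
  have c1 : chi 1%N = 1.
    have n0 : chi 1%N != 0 by rewrite supp.
    by apply: (mulfI n0); rewrite -mul mulr1.
  have c0 : chi 0%N = 0.
    by apply/eqP; apply: contraT; rewrite supp.
  have c2 : chi 2%N = -1.
    have a2 : (a %% 3 = 2)%N.
      case: (mod3P a) => // e.
      - by move: ca; rewrite coprime3E e.
      - by move: na1; rewrite perm e c1 eqxx.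
    have /eqP := sq a ca; rewrite sqrf_eq1 (negPf na1) /= perm a2.
    by move/eqP.
  by apply/funext => n; rewrite perm /chi3; case: (mod3P n) => ->.
have m1 : (-1 : R) != 1 by rewrite lt_eqF// (lt_trans _ (@ltr01 R))// ltrN10.
have cd : dirichlet_character 3 (chi3 R).
  split=> [n|m n|n].
  - by rewrite /chi3 modnDr.
  - rewrite chi3_mod -modnMm [chi3 R m]chi3_mod [chi3 R n]chi3_mod.
    by case: (mod3P m) => ->; case: (mod3P n) => ->;
      rewrite /chi3/= ?(mul0r, mulr0, mul1r, mulr1, mulrNN).
  - rewrite coprime3E /chi3.
    by case: (mod3P n) => -> /=; rewrite ?eqxx ?oppr_eq0 ?oner_eq0.
split; [split=> // d d3 dP|split].
- have : d \in divisors 3 by rewrite -dvdn_divisors.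
  rewrite [divisors 3](_ : _ = [:: 1; 3]%N)// !inE => /orP[|] /eqP // d1.
  have := dP 2%N isT; rewrite d1 !modn1 => /(_ erefl).
  by rewrite /chi3 /= => e; move: m1; rewrite e eqxx.
- move=> n; rewrite coprime3E /chi3.
  by case: (mod3P n) => -> //= _; rewrite ?expr1n ?sqrrN ?expr1n.
- by exists 2%N.
Qed.

(* Only integer arguments [s] at which the series converge are relevant. *)
Definition zeta (R : realType) (s : nat) : R :=
  limn (fun N => \sum_(1 <= n < N) (n%:R ^+ s)^-1 : R).

Definition dirichletL (R : realType) (s : nat) (chi : nat -> R) : R :=
  limn (fun N => \sum_(1 <= n < N) chi n * (n%:R ^+ s)^-1 : R).

(* Main.v *)
(* With s = m + n, the geometric sum over nu of 1/(n^nu s^(k+2-nu)) is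
     1/(m s n^k) - 1/(m s^(k+1)) = n^-(k+1) (1/m - 1/s) - 1/(m s^(k+1)).
   Sum the first part over m = n (mod 3) with n fixed: s runs over the integers
   > n congruent to 2n, so the inner series is
     chi_3(n) L(1; chi_3) + sum_(0 < x <= n, x = 2n mod 3) 1/x.
   Sum the second part over m with s fixed: the condition m = n reads m = 2s, and
   the inner sum is sum_(0 < m < s, m = 2s mod 3) 1/m. The finite harmonic sums
   cancel except for the terms x = n, present only when 3 | n, and these add up to
   3^-(k+2) zeta(k+2); the rest is L(1; chi_3) L(k+1; chi_3). Finally
   L(1; chi_3) = pi / (3 sqrt 3), the integral over [0, 1] of 1 / (1 + x + x^2). *)

Require Import Defs.
From mathcomp Require Import all_boot all_order all_algebra.
From mathcomp Require Import all_classical all_reals all_analysis.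
From mathcomp Require Import ring lra zify.
Import Order.TTheory GRing.Theory Num.Theory.
Import numFieldNormedType.Exports.
Local Open Scope classical_set_scope.
Local Open Scope ring_scope.

(** * The value of L(1; chi_3) *)

(** For b = [atan (Num.sqrt 3)^-1] one finds cos(2b) = 1/2 = sin b = cos(pi/2 - b), so 3b = pi/2 by
    injectivity of the cosine on [0, pi]. *)
Lemma atan_inv_sqrt3 {R : realType} : atan (Num.sqrt 3)^-1 = pi / 6 :> R.
Proof.
have s3 : Num.sqrt 3 ^+ 2 = 3 :> R by rewrite sqr_sqrtr// ler0n.
have s0 : 0 < Num.sqrt 3 :> R by rewrite sqrtr_gt0 ltr0n.
set b := atan _.
have b0 : 0 < b by rewrite -(@atan0 R) lt_atan// invr_gt0.
have b2 : b < pi / 2 := atan_ltpi2 _.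
have cb : cos b = Num.sqrt 3 / 2.
  rewrite cos_atan exprVn s3.
  have -> : 1 + 3^-1 = (2 / Num.sqrt 3) ^+ 2 :> R.
    by rewrite expr_div_n s3; lra.
  by rewrite sqrtr_sqr ger0_norm ?divr_ge0 ?ler0n ?(ltW s0)// invf_div.
have cb0 : cos b != 0 by rewrite cb mulf_neq0 ?gt_eqF ?invr_gt0 ?ltr0n.
have sb : sin b = 1 / 2.
  have : tan b = (Num.sqrt 3)^-1 by rewrite atanK.
  rewrite /tan cb => /(canRL (divfK _)) ->; last by rewrite -cb.
  by field; rewrite gt_eqF.
have e : b *+ 2 = pi / 2 - b.
  apply: cos_inj; rewrite ?in_itv/=; [lra|lra|].
  by rewrite -[in RHS]cosN opprB cosBpihalf sb cos_mulr2n cb expr_div_n s3; lra.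
lra.
Qed.

Lemma atan_sqrt3 {R : realType} : atan (Num.sqrt 3) = pi / 3 :> R.
Proof.
have s3 : Num.sqrt 3 ^+ 2 = 3 :> R by rewrite sqr_sqrtr// ler0n.
have s0 : 0 < Num.sqrt 3 :> R by rewrite sqrtr_gt0 ltr0n.
have p0 := pi_gt0 R.
have a0 : 0 < atan (Num.sqrt 3) :> R by rewrite -(@atan0 R) lt_atan.
have a2 : atan (Num.sqrt 3) < pi / 2 :> R := atan_ltpi2 _.
apply: cos_inj; rewrite ?in_itv/=; [lra|lra|].
have -> : pi / 3 = (pi / 6) *+ 2 :> R by lra.
rewrite cos_mulr2n -atan_inv_sqrt3 !cos_atan !exprVn s3.
have -> : 1 + 3 = 2 ^+ 2 :> R by lra.
have -> : 1 + 3^-1 = (2 / Num.sqrt 3) ^+ 2 :> R.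
  by rewrite expr_div_n s3; lra.
rewrite !sqrtr_sqr !ger0_norm ?divr_ge0 ?ler0n ?(ltW s0)//.
by rewrite expr_div_n s3; lra.
Qed.

Lemma chi3_sum0 {R : realType} n : chi3 R n + chi3 R n.+1 + chi3 R n.+2 = 0.
Proof.
rewrite /chi3 -(addn2 n) -(addn1 n) -(modnDml n 1) -(modnDml n 2).
by case: (mod3P n) => -> /=; lra.
Qed.

Lemma normr_chi3 {R : realType} n : `|chi3 R n| <= 1.
Proof. by rewrite /chi3; do 2?case: ifP; rewrite ?normrN ?normr1 ?normr0. Qed.

(** Three consecutive values of [chi3] sum to 0, so multiplying by 1 + x + x^2 leaves only boundary
    terms. *)
Lemma chi3_geometric_sum {R : realType} (x : R) M :
  (\sum_(0 <= i < M) chi3 R i.+1 * x ^+ i) * (1 + x + x ^+ 2) =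
  1 - chi3 R M.+1 * x ^+ M + chi3 R M * x ^+ M.+1.
Proof.
elim: M => [|M IH]; first by rewrite big_geq// /chi3/=; ring.
rewrite big_nat_recr//= mulrDl IH.
have /(canRL (addKr _)) -> := @chi3_sum0 R M.
by rewrite !exprS; ring.
Qed.

(** Both g - f and g + f are nondecreasing on [0, 1]. This replaces integrating the bound on the
    derivative. *)
Lemma ler_norm_derive01 {R : realType} (f g df dg : R -> R) :
  (forall x : R, is_derive x 1 f (df x)) -> (forall x : R, is_derive x 1 g (dg x)) ->
  (forall x : R, 0 <= x <= 1 -> `|df x| <= dg x) ->
  `|f 1 - f 0| <= g 1 - g 0.
Proof.
move=> hf hg hfg.
have mono (h dh : R -> R) : (forall x : R, is_derive x 1 h (dh x)) ->
    (forall x, 0 <= x <= 1 -> 0 <= dh x) -> h 0 <= h 1.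
  move=> hh dh0; apply: (@ger0_derive1_ndecr _ h 0 1) => //.
  - by move=> x; rewrite in_itv/= => /andP[x0 x1]; rewrite derive1E derive_val dh0 ?ltW.
  - apply: derivable_within_continuous => x _; exact: ex_derive.
have h1 : g 0 - f 0 <= g 1 - f 1.
  apply: (mono (g \- f) (fun x => dg x - df x)) => x /hfg.
  by rewrite subr_ge0; apply: le_trans; exact: ler_norm.
have h2 : g 0 + f 0 <= g 1 + f 1.
  apply: (mono (g \+ f) (fun x => dg x + df x)) => x /hfg.
  by rewrite ler_norml => /andP[? _]; lra.
by rewrite ler_norml; apply/andP; split; lra.
Qed.

Lemma is_derive_monomial {R : realType} (c : R) n (x : R) :
  is_derive x 1 (fun y : R => c / n.+1%:R * y ^+ n.+1) (c * x ^+ n).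
Proof.
have -> : (fun y : R => c / n.+1%:R * y ^+ n.+1) =
    (c / n.+1%:R) \*: ((@id R) ^+ n.+1) by apply/funext => y; rewrite exprfctE.
apply: is_derive_eq.
by rewrite /GRing.scale/= mulr1 mulrA divfK// pnatr_eq0.
Qed.

Lemma is_derive_power_sum {R : realType} (c : nat -> R) N (x : R) :
  is_derive x 1 (fun y : R => \sum_(0 <= i < N) c i / i.+1%:R * y ^+ i.+1)
    (\sum_(0 <= i < N) c i * x ^+ i).
Proof.
elim: N => [|N IH].
  rewrite big_geq//; under eq_fun do rewrite big_geq//.
  exact: is_derive_cst.
rewrite big_nat_recr//=.
under eq_fun do rewrite big_nat_recr//=.
apply: is_deriveD; exact: is_derive_monomial.
Qed.

(** The function [f] is a primitive of 1/(1 + x + x^2) minus its truncated power series. Its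
    derivative is at most 2 x^M in absolute value on [0, 1], and [g] is a primitive of that
    bound. *)
Lemma L1chi3_remainder {R : realType} M :
  `|pi / (3 * Num.sqrt 3) - \sum_(0 <= i < M) chi3 R i.+1 / i.+1%:R|
    <= 2 / M.+1%:R.
Proof.
have s3 : Num.sqrt 3 ^+ 2 = 3 :> R by rewrite sqr_sqrtr// ler0n.
have s0 : 0 < Num.sqrt 3 :> R by rewrite sqrtr_gt0 ltr0n.
pose f (x : R) : R := 2 / Num.sqrt 3 * atan ((2 * x + 1) / Num.sqrt 3) -
  \sum_(0 <= i < M) chi3 R i.+1 / i.+1%:R * x ^+ i.+1.
pose g (x : R) : R := 2 / M.+1%:R * x ^+ M.+1.
pose df (x : R) : R := (1 + x + x ^+ 2)^-1 - \sum_(0 <= i < M) chi3 R i.+1 * x ^+ i.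
have q0 x : 0 < 1 + x + x ^+ 2 :> R.
  by have := sqr_ge0 (x + 1 / 2); rewrite sqrrD expr_div_n; lra.
have hf (x : R) : is_derive x 1 f (df x).
  apply: is_deriveB; last exact: (is_derive_power_sum (fun i => chi3 R i.+1)).
  have ha : is_derive x 1 (fun y : R => (2 * y + 1) / Num.sqrt 3) (2 / Num.sqrt 3).
    have -> : (fun y : R => (2 * y + 1) / Num.sqrt 3) =
      (2 / Num.sqrt 3) \*: @id R + cst (1 / Num.sqrt 3).
      by apply/funext => y /=; rewrite /GRing.scale/= mulrDl mulrAC.
    by apply: is_derive_eq; rewrite /GRing.scale/= addr0 mulr1.
  have hc := is_derive1_comp (is_derive1_atan _) ha.
  apply: (@is_derive_eq _ _ _
    ((2 / Num.sqrt 3) \*: (atan \o (fun y : R => (2 * y + 1) / Num.sqrt 3)))).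
  rewrite /GRing.scale/= expr_div_n s3.
  (* Completing the square explains the argument (2x + 1)/sqrt 3 of the arctangent. *)
  have -> : 1 + (2 * x + 1) ^+ 2 / 3 = 4 / 3 * (1 + x + x ^+ 2) :> R by field.
  by rewrite mulrCA -expr2 expr_div_n s3; field; rewrite gt_eqF.
have hg (x : R) : is_derive x 1 g (2 * x ^+ M) by exact: is_derive_monomial.
have dfg (x : R) : 0 <= x <= 1 -> `|df x| <= 2 * x ^+ M.
  move=> /andP[x0 x1].
  have -> : df x = (chi3 R M.+1 * x ^+ M - chi3 R M * x ^+ M.+1) / (1 + x + x ^+ 2).
    apply: (mulIf (lt0r_neq0 (q0 x))).
    rewrite divfK ?gt_eqF// mulrBl chi3_geometric_sum mulVf ?gt_eqF//; ring.
  rewrite normrM [X in _ * X]ger0_norm ?invr_ge0 ?(ltW (q0 x))// ler_pdivrMr//.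
  apply: le_trans (ler_normB _ _) _.
  have xM := exprn_ge0 M x0.
  have xM1 : x ^+ M.+1 <= x ^+ M by rewrite exprS ler_piMl.
  have xM2 := exprn_ge0 M.+1 x0.
  rewrite !normrM !(ger0_norm (exprn_ge0 _ x0)).
  have := ler_wpM2r xM (normr_chi3 M.+1); have := ler_wpM2r xM2 (normr_chi3 M).
  rewrite !mul1r => h1 h2.
  have : 2 * x ^+ M <= 2 * x ^+ M * (1 + x + x ^+ 2).
    by rewrite ler_peMr ?mulr_ge0// -addrA lerDl addr_ge0// sqr_ge0.
  lra.
have := ler_norm_derive01 f g df _ hf hg dfg.
have -> : g 1 - g 0 = 2 / M.+1%:R by rewrite /g expr1n exprS mul0r mulr0 subr0 mulr1.
have -> // : f 1 - f 0 =
    pi / (3 * Num.sqrt 3) - \sum_(0 <= i < M) chi3 R i.+1 / i.+1%:R.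
have -> : f 0 = 2 / Num.sqrt 3 * (pi / 6).
  rewrite /f mulr0 add0r div1r atan_inv_sqrt3 big1 ?subr0// => i _.
  by rewrite exprS mul0r mulr0.
have -> : f 1 = 2 / Num.sqrt 3 * (pi / 3) - \sum_(0 <= i < M) chi3 R i.+1 / i.+1%:R.
  rewrite /f; congr (_ - _); last by apply: eq_bigr => i _; rewrite expr1n mulr1.
  rewrite -atan_sqrt3; congr (_ * atan _).
  have -> : 2 * 1 + 1 = Num.sqrt 3 ^+ 2 :> R by rewrite s3; ring.
  by rewrite expr2 mulfK// gt_eqF.
by field; rewrite gt_eqF.
Qed.

Lemma cvg_L1chi3 {R : realType} :
  (fun N => \sum_(1 <= n < N) chi3 R n / n%:R) @ \oo --> pi / (3 * Num.sqrt 3).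
Proof.
rewrite -cvg_shiftS /=.
under eq_fun do rewrite big_add1/=.
apply/cvgrPdist_le => e e0.
near=> M.
apply: le_trans (L1chi3_remainder M) _.
rewrite ler_pdivrMr ?ltr0n// mulrC -ler_pdivrMr//.
rewrite -(natr1 M) -lerBlDr.
near: M; exact: nbhs_infty_ger.
Unshelve. all: by end_near.
Qed.

(** * Series over the natural numbers: convergence and bounds *)

Lemma sum_nat_from1 {R : realType} (u : nat -> R) N : u 0%N = 0 ->
  \sum_(1 <= n < N) u n = \sum_(0 <= n < N) u n.
Proof.
by case: N => [|N] u0; [rewrite !big_geq|rewrite [RHS]big_ltn// u0 add0r].
Qed.

Lemma sum_nat_pos {R : realType} (u : nat -> R) N : u 0%N = 0 ->
  \sum_(0 <= n < N | (0 < n)%N) u n = \sum_(0 <= n < N) u n.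
Proof. by move=> u0; rewrite big_mkcond/=; apply: eq_bigr => -[|n] _ /=. Qed.

Lemma esum_nat_cvg {R : realType} (P : pred nat) (u : nat -> R) l :
  (forall n, P n -> 0 <= u n) ->
  (fun N => \sum_(0 <= n < N | P n) u n) @ \oo --> l ->
  \esum_(n in [set n | P n]) (u n)%:E = l%:E.
Proof.
move=> u0 ul; rewrite -nneseries_esum; last by move=> n Pn; rewrite lee_fin u0.
apply/cvg_lim => //; under eq_fun do rewrite sumEFin.
by apply: cvg_EFin => //; apply: nearW.
Qed.

Lemma is_cvg_bounded_series {R : realType} (u : nat -> R) C : (forall n, 0 <= u n) ->
  (forall N, \sum_(0 <= n < N) u n <= C) -> cvgn (series u).
Proof.
move=> u0 uC; apply: nondecreasing_is_cvgn.
  by apply: nondecreasing_series => n _ _.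
by exists C => _ [N _ <-]; exact: uC.
Qed.

Lemma sum_inv_sqr_le {R : realType} N : \sum_(0 <= n < N) ((n%:R ^+ 2)^-1 : R) <= 2.
Proof.
case: N => [|N]; first by rewrite big_geq.
rewrite big_ltn// expr0n invr0 add0r big_add1/=.
(* The added 1/N makes the induction work: 1/(N+1)^2 <= 1/N - 1/(N+1). The value 1 at N = 0 only
   avoids the inverse of 0. *)
suff : \sum_(0 <= n < N) ((n.+1%:R ^+ 2)^-1 : R) + (if N is 0 then 1 else N%:R^-1) <= 2.
  apply: le_trans; rewrite lerDl; by case: N.
elim: N => [|[|N] IH]; first by rewrite big_geq// add0r ler1n.
  by rewrite big_nat1 expr1n invr1; lra.
rewrite big_nat_recr//=.
apply: le_trans IH; rewrite -addrA lerD2l.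
have a0 : 0 < N.+1%:R :> R by rewrite ltr0n.
rewrite -natr1; move: (N.+1%:R) a0 => a a0.
rewrite -subr_ge0.
rewrite (_ : _ - _ = (a * (a + 1) ^+ 2)^-1).
  by rewrite invr_ge0 mulr_ge0 ?sqr_ge0 ?ltW.
by field; rewrite !gt_eqF//; lra.
Qed.

(* With H_n = sum_(m < n) 1/m, the quantity (H_n + 1) / (n - 1) decreases by at
   least H_n / n^2 from n to n + 1. *)
Lemma sum_harmonic_sqr_le {R : realType} N :
  \sum_(0 <= n < N) ((n%:R ^+ 2)^-1 * \sum_(0 <= m < n) m%:R^-1 : R) <= 2.
Proof.
have H0 n : 0 <= \sum_(0 <= m < n) (m%:R^-1 : R) by apply: sumr_ge0.
have T0 n : 0 <= (n%:R ^+ 2)^-1 * \sum_(0 <= m < n) (m%:R^-1 : R).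
  by rewrite mulr_ge0// invr_ge0 sqr_ge0.
suff h : \sum_(0 <= n < N.+2) ((n%:R ^+ 2)^-1 * \sum_(0 <= m < n) m%:R^-1 : R)
    + (\sum_(0 <= m < N.+2) m%:R^-1 + 1) / N.+1%:R <= 2.
  apply: le_trans h; rewrite !big_nat_recr//= -!addrA lerDl.
  by rewrite !addr_ge0 ?mulr_ge0 ?addr_ge0//.
elim: N => [|N IH].
  by rewrite !(big_nat_recr, big_geq)//=; rewrite !(invr0,expr0n,invr1,mulr0,add0r); lra.
apply: le_trans IH; rewrite big_nat_recr//= -addrA lerD2l.
rewrite [in X in _ + X]big_nat_recr//=.
have := H0 N.+2; move: (\sum_(0 <= m < N.+2) _) => h h0.
have a0 : 0 < N.+1%:R :> R by rewrite ltr0n.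
rewrite -(natr1 N.+1); move: (N.+1%:R) a0 => a a0.
rewrite -subr_ge0.
rewrite (_ : _ - _ = (h + 1) * (a * (a + 1) ^+ 2)^-1).
  by rewrite mulr_ge0 ?addr_ge0// invr_ge0 mulr_ge0 ?sqr_ge0 ?ltW.
by field; rewrite !gt_eqF//; lra.
Qed.

Lemma inv_pow_le_sqr {R : realType} s n : (1 < s)%N -> (n%:R ^+ s)^-1 <= (n%:R ^+ 2)^-1 :> R.
Proof.
case: n => [|n] s1; first by rewrite !expr0n !gtn_eqF// ltnW.
by rewrite lef_pV2 ?posrE ?exprn_gt0 ?ltr0n// ler_weXn2l// ler1n.
Qed.

Lemma cvg_zeta {R : realType} s : (1 < s)%N ->
  (fun N => \sum_(0 <= n < N) ((n%:R ^+ s)^-1 : R)) @ \oo --> zeta R s.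
Proof.
move=> s1.
have -> : zeta R s = limn (series (fun n => (n%:R ^+ s)^-1 : R)).
  (* Starting at n = 0 is harmless, since the inverse of 0 is 0. *)
  congr (limn _); apply/funext => N; rewrite sum_nat_from1//.
  by rewrite expr0n gtn_eqF ?invr0// ltnW.
apply: (@is_cvg_bounded_series _ _ 2) => [n|N].
  by rewrite invr_ge0 exprn_ge0.
apply: le_trans (sum_inv_sqr_le N).
by apply: ler_sum => n _; exact: inv_pow_le_sqr.
Qed.

Lemma cvg_dirichletL_chi3 {R : realType} s : (1 < s)%N ->
  (fun N => \sum_(0 <= n < N) (chi3 R n * (n%:R ^+ s)^-1)) @ \oo -->
  dirichletL s (chi3 R).
Proof.
move=> s1.
have -> : dirichletL s (chi3 R) = limn (series (fun n => chi3 R n * (n%:R ^+ s)^-1)).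
  congr (limn _); apply/funext => N; rewrite sum_nat_from1//.
  by rewrite expr0n gtn_eqF ?invr0 ?mulr0// ltnW.
apply: normed_cvg.
apply: series_le_cvg (cvgP _ (cvg_zeta s s1)) => n /=; [by []|by rewrite invr_ge0 exprn_ge0|].
rewrite normrM [X in _ * X]ger0_norm ?invr_ge0 ?exprn_ge0//.
by rewrite ler_piMl ?invr_ge0 ?exprn_ge0// normr_chi3.
Qed.

Lemma cvg_zeta_mul3 {R : realType} s : (1 < s)%N ->
  (fun N => \sum_(0 <= n < N) (if (3 %| n)%N then (n%:R ^+ s)^-1 else 0 : R))
    @ \oo --> (3 ^+ s)^-1 * zeta R s.
Proof.
move=> s1; pose u n : R := if (3 %| n)%N then (n%:R ^+ s)^-1 else 0.
have uc : cvgn (series u).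
  apply: series_le_cvg (cvgP _ (cvg_zeta s s1)) => n //=; rewrite /u;
    by case: ifP; rewrite ?lexx ?invr_ge0 ?exprn_ge0.
(* As the series converges, its limit can be read off along the partial sums of 3N terms, whose
   nonzero terms have n = 3j with j < N. *)
suff : series u (3 * N)%N @[N --> \oo] --> (3 ^+ s)^-1 * zeta R s.
  move=> h.
  have h' : series u (3 * N)%N @[N --> \oo] --> limn (series u).
    by apply: cvg_comp uc; exact: cvg_mulnl.
  by rewrite (cvg_unique _ h h').
rewrite (_ : (fun N => _) = (fun N => (3 ^+ s)^-1 * \sum_(0 <= n < N) (n%:R ^+ s)^-1)).
  by apply: cvgMr; exact: cvg_zeta.
apply/funext; elim=> [|N IH]; first by rewrite /series/= !big_geq// mulr0.
rewrite /series/= in IH *.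
rewrite mulnS addnC addn3 !big_nat_recr//= mulrDr -IH -!addrA.
have d1 : (3 %| (3 * N).+1)%N = false by lia.
have d2 : (3 %| (3 * N).+2)%N = false by lia.
rewrite /u dvdn_mulr// d1 d2 !addr0.
by rewrite natrM exprMn invfM.
Qed.

(** * The geometric sum over nu and the inner sums over residue classes *)

(** Used with x = n and z = m. The subtracted term is moved to the left, so that every summand on
    that side is nonnegative and extended sums can be split. *)
Lemma geometric_partial_fraction {R : realType} (k : nat) (x z : R) : 0 < x -> 0 < z ->
  \sum_(1 <= nu < k.+1) (x ^+ nu * (z + x) ^+ (k + 2 - nu))^-1 +
    (z * (z + x) ^+ (k + 1))^-1 =
  (x ^+ (k + 1))^-1 * (z^-1 - (z + x)^-1).
Proof.
move=> x0 z0; have y0 := addr_gt0 z0 x0.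
have [xn zn yn] : [/\ x != 0, z != 0 & z + x != 0] by rewrite !gt_eqF.
elim: k => [|k IH].
  by rewrite big_geq// add0r !expr1; field; rewrite xn zn yn.
(* From k to k + 1 each old term gains a factor 1/(z + x); only the term nu = k + 1 is new. *)
rewrite big_nat_recr//= (eq_big_nat _ _ (F2 := fun nu =>
  (z + x)^-1 * (x ^+ nu * (z + x) ^+ (k + 2 - nu))^-1)); last first.
  move=> nu /andP[_ nuk]; rewrite addSn subSn ?exprS; last by lia.
  by rewrite -invfM; congr (_^-1); ring.
rewrite -big_distrr/=; move/(canRL (addrK _)): IH => ->.
rewrite (_ : k.+1 + 2 - k.+1 = 2)%N; last by lia.
rewrite (_ : k.+1 + 1 = (k + 1).+1)%N; last by lia.
rewrite -[X in x ^+ X * _]addn1 !exprS.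
have : x ^+ (k + 1) != 0 by rewrite expf_neq0.
have : (z + x) ^+ (k + 1) != 0 by rewrite expf_neq0.
move: (x ^+ (k + 1)) ((z + x) ^+ (k + 1)) => a b b0 a0.
by field; rewrite xn zn yn a0 b0.
Qed.

(* For 0 < m < n, the condition m = 2n (mod 3) says that m = n - m (mod 3).
   The term at m = 0 is 0^-1 = 0. *)
Definition half_class_harmonic (R : realType) (n : nat) : R :=
  \sum_(0 <= m < n | m == (2 * n)%N %[mod 3]) m%:R^-1.

(** If 3 divides n, the classes of n and 2n coincide and both sides vanish; otherwise they are the
    two nonzero classes, where chi_3(n) chi_3(m) is 1 and -1 respectively. *)
Lemma chi3_indicator {R : realType} (n m : nat) :
  (m == n %[mod 3])%:R - (m == (2 * n)%N %[mod 3])%:R = chi3 R n * chi3 R m.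
Proof.
rewrite /chi3 -(modnMmr 2 n).
by case: (mod3P n) => ->; case: (mod3P m) => -> /=; ring.
Qed.

(** Putting x = m + n turns the subtracted sum into one over the class of 2n, on a range shifted by
    n. Compared with the range below N + 1, it lacks the terms x < n and has n extra positions,
    which form the last sum. *)
Lemma sum_class_diff {R : realType} n N : (0 < n)%N ->
  \sum_(0 <= m < N.+1 | (0 < m)%N && (m == n %[mod 3])) (m%:R^-1 - (m + n)%:R^-1)
  = chi3 R n * (\sum_(0 <= m < N.+1) chi3 R m / m%:R) + half_class_harmonic R n
    + (if (3 %| n)%N then n%:R^-1 else 0)
    - \sum_(0 <= i < n | (N.+1 + i)%N == (2 * n)%N %[mod 3]) (N.+1 + i)%:R^-1 :> R.
Proof.
move=> n0.
(* Allowing m = 0 adds the term -1/n exactly when 3 divides n; its compensation is the source of the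
   zeta value. *)
have -> : \sum_(0 <= m < N.+1 | (0 < m)%N && (m == n %[mod 3]))
      (m%:R^-1 - (m + n)%:R^-1) =
    \sum_(0 <= m < N.+1 | m == n %[mod 3]) (m%:R^-1 - (m + n)%:R^-1)
      + (if (3 %| n)%N then n%:R^-1 else 0) :> R.
  rewrite big_mkcond [in RHS]big_mkcond/= !(big_ltn (m := 0))//= add0r addrAC.
  rewrite mod0n (eq_sym 0%N) -/(dvdn 3 n) add0n invr0 add0r.
  rewrite (_ : (if _ then - _ else 0) + _ = 0) ?add0r; last first.
    by case: ifP; rewrite ?addNr ?addr0.
  by apply: eq_big_nat => m /andP[-> _].
rewrite sumrB.
have -> : \sum_(0 <= m < N.+1 | m == n %[mod 3]) ((m + n)%:R^-1 : R) =
    \sum_(n <= x < N.+1 + n | x == (2 * n)%N %[mod 3]) x%:R^-1.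
  rewrite -{3}[n]add0n big_addn addnK; apply: eq_bigl => m.
  by rewrite mul2n -addnn eqn_modDr.
have <- : \sum_(N.+1 <= x < N.+1 + n | x == (2 * n)%N %[mod 3]) (x%:R^-1 : R) =
    \sum_(0 <= i < n | (N.+1 + i)%N == (2 * n)%N %[mod 3]) (N.+1 + i)%:R^-1.
  rewrite -{1}[N.+1]add0n big_addn addKn.
  by apply: eq_big => [i|i _]; rewrite addnC.
(* The same range is cut at n here, and at N + 1 in [e2]. *)
have e1 : \sum_(0 <= x < N.+1 + n | x == (2 * n)%N %[mod 3]) (x%:R^-1 : R) =
    half_class_harmonic R n + \sum_(n <= x < N.+1 + n | x == (2 * n)%N %[mod 3]) x%:R^-1.
  by rewrite -big_cat_nat// leq_addl.
have e2 : \sum_(0 <= x < N.+1 + n | x == (2 * n)%N %[mod 3]) (x%:R^-1 : R) =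
    \sum_(0 <= x < N.+1 | x == (2 * n)%N %[mod 3]) x%:R^-1
    + \sum_(N.+1 <= x < N.+1 + n | x == (2 * n)%N %[mod 3]) x%:R^-1.
  by rewrite -big_cat_nat// leq_addr.
have e3 : chi3 R n * (\sum_(0 <= m < N.+1) chi3 R m / m%:R) =
   \sum_(0 <= x < N.+1 | x == n %[mod 3]) x%:R^-1 -
   \sum_(0 <= x < N.+1 | x == (2 * n)%N %[mod 3]) (x%:R^-1 : R).
  rewrite big_distrr/= [in RHS]big_mkcond [X in _ - X]big_mkcond -sumrB/=.
  apply: eq_bigr => m _; rewrite mulrA -chi3_indicator mulrBl.
  by do 2!case: ifP => _; rewrite ?mul1r ?mul0r.
rewrite e3; lra.
Qed.

(** There are at most n terms, each at most 1/(N + 1). The predicate may vary with N, as the residue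
    condition on N + 1 + i does. *)
Lemma cvg_class_tail {R : realType} n (P : nat -> pred nat) :
  (fun N => \sum_(0 <= i < n | P N i) ((N.+1 + i)%:R^-1 : R)) @ \oo --> 0.
Proof.
apply/cvgrPdist_le => e e0; near=> N.
rewrite sub0r normrN ger0_norm; last by apply: sumr_ge0.
apply: (@le_trans _ _ (\sum_(0 <= i < n) N.+1%:R^-1)).
  rewrite big_mkcond/=; apply: ler_sum => i _.
  by case: ifP => // _; rewrite lef_pV2 ?posrE ?ltr0n ?addSn// ler_nat ltnS leq_addr.
rewrite sumr_const_nat subn0 -[_ *+ n]mulr_natl ler_pdivrMr ?ltr0n//.
rewrite mulrC -ler_pdivrMr// -(natr1 N) -lerBlDr.
near: N; exact: nbhs_infty_ger.
Unshelve. all: by end_near.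
Qed.

Lemma cvg_class_diff {R : realType} n : (0 < n)%N ->
  (fun N => \sum_(0 <= m < N | (0 < m)%N && (m == n %[mod 3]))
     (m%:R^-1 - (m + n)%:R^-1)) @ \oo -->
  chi3 R n * (pi / (3 * Num.sqrt 3)) + half_class_harmonic R n
    + (if (3 %| n)%N then n%:R^-1 else 0).
Proof.
move=> n0; rewrite -cvg_shiftS/=.
under eq_fun do rewrite (sum_class_diff _ _ n0).
rewrite -[_ + (if _ then _ else 0)]subr0.
apply: cvgB; last exact: cvg_class_tail.
apply: cvgD; last exact: cvg_cst.
apply: cvgD; last exact: cvg_cst.
apply: cvgMr.
under eq_fun do rewrite -sum_nat_from1 ?invr0 ?mulr0//.
have := @cvg_L1chi3 R; rewrite -cvg_shiftS; exact.
Qed.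

Lemma half_class_harmonic_ge0 {R : realType} n : 0 <= half_class_harmonic R n.
Proof. by apply: sumr_ge0. Qed.

(** Dropping the congruence and lowering the exponent to 2 reduces this to [sum_harmonic_sqr_le]. *)
Lemma is_cvg_series_half_class_harmonic {R : realType} s : (1 < s)%N ->
  cvgn (series (fun n => (n%:R ^+ s)^-1 * half_class_harmonic R n)).
Proof.
move=> s1; apply: (@is_cvg_bounded_series _ _ 2) => [n|N].
  by rewrite mulr_ge0 ?half_class_harmonic_ge0// invr_ge0 exprn_ge0.
apply: le_trans (sum_harmonic_sqr_le N); apply: ler_sum => n _.
apply: ler_pM; rewrite ?half_class_harmonic_ge0 ?invr_ge0 ?exprn_ge0//.
  exact: inv_pow_le_sqr.
by rewrite /half_class_harmonic big_mkcond/=; apply: ler_sum => m _; case: ifP.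
Qed.

(** * Double sums over congruent pairs, in two orders of summation *)

Definition congruent_pairs : set (nat * nat) :=
  [set p | [/\ (1 <= p.1)%N, (1 <= p.2)%N & p.1 = p.2 %[mod 3]]].

Lemma esum_congruent_by_second (R : realType) (a : nat * nat -> \bar R) :
  (forall p, congruent_pairs p -> (0 <= a p)%E) ->
  (\esum_(p in congruent_pairs) a p =
   \esum_(n in [set n | (0 < n)%N])
     \esum_(m in [set m | (0 < m)%N && (m == n %[mod 3])]) a (m, n))%E.
Proof.
move=> a0; rewrite esum_esum; last first.
  by move=> n m /= n0 /andP[m0 /eqP mn]; apply: a0.
rewrite (@reindex_esum _ _ _
  ([set n | (0 < n)%N] `*`` (fun n => [set m | (0 < m)%N && (m == n %[mod 3])]))
  _ (fun q => (q.2, q.1))) //.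
split.
- by move=> [n m] /= [n0 /andP[m0 /eqP mn]]; split.
- by move=> [n m] [n' m'] _ _ /= [-> ->].
- move=> [m n] [/= m0 n0 mn]; exists (n, m) => //=.
  by split => //; rewrite m0 mn eqxx.
Qed.

Lemma esum_congruent_by_sum (R : realType) (a : nat * nat -> \bar R) :
  (forall p, congruent_pairs p -> (0 <= a p)%E) ->
  (\esum_(p in congruent_pairs) a p =
   \esum_(s in [set s | (0 < s)%N])
     \esum_(m in [set m | [&& (0 < m)%N, (m < s)%N & m == 2 * s %[mod 3]]])
       a (m, s - m)%N)%E.
Proof.
move=> a0.
(* The condition 2m = s (mod 3) is solved for m, 2 being its own inverse mod 3; m < s makes the
   natural subtraction exact. *)
have congr_half m s : (m < s)%N -> (m == 2 * s %[mod 3]) = (m == s - m %[mod 3]).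
  by move=> ms; apply/idP/idP => /eqP h; apply/eqP; lia.
rewrite esum_esum; last first.
  move=> s m /= s0 /and3P[m0 ms]; rewrite congr_half// => /eqP h.
  by apply: a0; split=> //=; rewrite subn_gt0.
rewrite (@reindex_esum _ _ _
  ([set s | (0 < s)%N] `*`` (fun s =>
    [set m | [&& (0 < m)%N, (m < s)%N & m == 2 * s %[mod 3]]]))
  _ (fun q => (q.2, q.1 - q.2)%N)) //.
split.
- move=> [s m] /= [s0 /and3P[m0 ms]]; rewrite congr_half// => /eqP h.
  by split=> //=; rewrite subn_gt0.
- move=> [s m] [s' m']; rewrite !inE /= => -[_ /and3P[_ ms _]] [_ /and3P[_ ms' _]].
  by case=> mm; subst m' => h; congr pair; lia.
- move=> [m n] [/= m0 n0 mn]; exists (m + n, m)%N => /=; last by rewrite addKn.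
  split; first by rewrite addn_gt0 m0.
  rewrite m0 congr_half; last by lia.
  by rewrite addKn mn eqxx andbT; lia.
Qed.

Lemma esum_half_class_harmonic (R : realType) (s : nat) : (1 < s)%N ->
  \esum_(p in congruent_pairs) ((p.1%:R * (p.1 + p.2)%:R ^+ s)^-1 : R)%:E
  = (limn (series (fun n => (n%:R ^+ s)^-1 * half_class_harmonic R n)))%:E.
Proof.
move=> s1; rewrite esum_congruent_by_sum; last first.
  by move=> p _; rewrite lee_fin invr_ge0 mulr_ge0// exprn_ge0.
under eq_esum => n n0.
  rewrite (esum_nat_cvg _ _ ((n%:R ^+ s)^-1 * half_class_harmonic R n)); last 2 first.
  - by move=> m _; rewrite invr_ge0 mulr_ge0// exprn_ge0.
  (* The inner sum involves only m < n, so its partial sums are constant once N >= n. *)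
  - apply: cvg_near_cst; near=> N.
    have nN : (n <= N)%N by near: N; exact: nbhs_infty_ge.
    rewrite (big_cat_nat (n := n))//= [X in _ + X]big1_seq ?addr0; last first.
      move=> m /andP[/and3P[_ mn _]]; rewrite mem_index_iota; lia.
    rewrite /half_class_harmonic big_distrr/= big_mkcond [RHS]big_mkcond/=.
    apply: eq_big_nat => -[|m] /andP[_ mn] /=; first by rewrite invr0 mulr0; case: ifP.
    by rewrite mn/= subnKC ?(ltnW mn)// invfM mulrC.
  over.
apply: esum_nat_cvg => [n _|].
  by rewrite mulr_ge0 ?half_class_harmonic_ge0// invr_ge0 exprn_ge0.
under eq_fun do rewrite sum_nat_pos ?expr0n ?gtn_eqF ?invr0 ?mul0r ?(ltnW s1)//.
exact: is_cvg_series_half_class_harmonic.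
Unshelve. all: by end_near.
Qed.

(** The pairs are grouped by n. The harmonic series stays as an unevaluated limit, the same as in
    [esum_half_class_harmonic], ready to be cancelled. *)
Lemma esum_class_diff (R : realType) (s : nat) : (1 < s)%N ->
  \esum_(p in congruent_pairs)
    ((p.2%:R ^+ s)^-1 * (p.1%:R^-1 - (p.1 + p.2)%:R^-1) : R)%:E
  = ((3 ^+ s.+1)^-1 * zeta R s.+1 + pi / (3 * Num.sqrt 3) * dirichletL s (chi3 R)
     + limn (series (fun n => (n%:R ^+ s)^-1 * half_class_harmonic R n)))%:E.
Proof.
move=> s1.
have diff_ge0 m n : (0 < m)%N -> 0 <= (m%:R^-1 - (m + n)%:R^-1 : R).
  by move=> m0; rewrite subr_ge0 lef_pV2 ?posrE ?ltr0n ?addn_gt0 ?m0// ler_nat leq_addr.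
have term_ge0 m n : (0 < m)%N ->
    0 <= ((n%:R ^+ s)^-1 * (m%:R^-1 - (m + n)%:R^-1) : R).
  by move=> m0; rewrite mulr_ge0 ?diff_ge0// invr_ge0 exprn_ge0.
rewrite esum_congruent_by_second; last by move=> p [p0 _ _]; rewrite lee_fin term_ge0.
pose A (n : nat) : R := chi3 R n * (pi / (3 * Num.sqrt 3)) + half_class_harmonic R n
    + (if (3 %| n)%N then n%:R^-1 else 0).
have innerE n : (0 < n)%N ->
  (fun N => \sum_(0 <= m < N | (0 < m)%N && (m == n %[mod 3]))
   ((n%:R ^+ s)^-1 * (m%:R^-1 - (m + n)%:R^-1) : R)) @ \oo --> (n%:R ^+ s)^-1 * A n.
  move=> n0; under eq_fun do rewrite -big_distrr/=.
  by apply: cvgMr; exact: cvg_class_diff.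
under eq_esum => n n0.
  rewrite (esum_nat_cvg _ _ _ _ (innerE _ n0)); last first.
    by move=> m /andP[m0 _]; exact: term_ge0.
  over.
apply: esum_nat_cvg => [n n0|].
  (* The formula for [A n] contains the signed chi_3(n), so its nonnegativity is obtained from the
     partial sums converging to it. *)
  rewrite -(cvg_lim _ (innerE _ n0))//; apply: limr_ge.
    by apply/cvg_ex; exists ((n%:R ^+ s)^-1 * A n); exact: innerE.
  by apply: nearW => N; apply: sumr_ge0 => m /andP[m0 _]; exact: term_ge0.
under eq_fun do rewrite sum_nat_pos ?expr0n ?gtn_eqF ?invr0 ?mul0r ?(ltnW s1)//.
have -> : (fun N => \sum_(0 <= n < N) (n%:R ^+ s)^-1 * A n) = (fun N =>
   \sum_(0 <= n < N) (if (3 %| n)%N then (n%:R ^+ s.+1)^-1 else 0)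
   + pi / (3 * Num.sqrt 3) * (\sum_(0 <= n < N) (chi3 R n * (n%:R ^+ s)^-1))
   + series (fun n => (n%:R ^+ s)^-1 * half_class_harmonic R n) N).
  apply/funext => N; rewrite /series/= big_distrr -!big_split/=; apply: eq_bigr => n _.
  rewrite /A exprS [(_ * n%:R ^+ s)^-1]invfM.
  by move: ((n%:R ^+ s)^-1) (n%:R^-1) (pi / _) => a b c; case: ifP => _; ring.
apply: cvgD; last exact: is_cvg_series_half_class_harmonic.
apply: cvgD; first by apply: cvg_zeta_mul3; exact: ltnW.
by apply: cvgMr; exact: cvg_dirichletL_chi3.
Qed.

Theorem corollary1p7 (R : realType) (k : nat) (hk : (0 < k)%N) :
  (\sum_(1 <= nu < k.+1)
     \esum_(p in [set p : nat * nat |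
                   [/\ (1 <= p.1)%N, (1 <= p.2)%N & p.1 = p.2 %[mod 3]]])
       ((p.2%:R ^+ nu * (p.1 + p.2)%:R ^+ (k + 2 - nu))^-1 : R)%:E)%E
  = ((3 ^+ (k + 2))^-1 * zeta R (k + 2)%N
     + pi / (3 * Num.sqrt 3) * dirichletL (k + 1)%N (chi3 R))%:E.
Proof.
have k1 : (1 < k + 1)%N by rewrite addn1 ltnS.
have term_ge0 (p : nat * nat) nu :
    0 <= ((p.2%:R ^+ nu * (p.1 + p.2)%:R ^+ (k + 2 - nu))^-1 : R).
  by rewrite invr_ge0 mulr_ge0 ?exprn_ge0.
rewrite -esum_sum; last by move=> p nu _ _; rewrite lee_fin.
have := esum_class_diff R _ k1; rewrite EFinD -esum_half_class_harmonic//.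
(* The partial fraction identity is applied under the sum, from right to left. *)
rewrite (eq_esum (b := fun p : nat * nat => (\sum_(1 <= nu < k.+1)
    ((p.2%:R ^+ nu * (p.1 + p.2)%:R ^+ (k + 2 - nu))^-1 : R)%:E
    + ((p.1%:R * (p.1 + p.2)%:R ^+ (k + 1))^-1)%:E)%E)); last first.
  move=> p [m0 n0 _].
  by rewrite sumEFin -EFinD natrD geometric_partial_fraction ?ltr0n.
rewrite esumD; last 2 first.
- by move=> p _; apply: sume_ge0 => nu _; rewrite lee_fin.
- by move=> p _; rewrite lee_fin invr_ge0 mulr_ge0 ?exprn_ge0.
rewrite esum_half_class_harmonic// -(addn1 (k + 1)) -addnA.
(* Both sides contain the real number [l]; being finite, it can be cancelled in the extended
   reals. *)
set l := limn _ => /(congr1 (fun x : \bar R => x - l%:E)%E) /=.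
by rewrite !addeK.
Qed.
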